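(* For any irreducible right-angled Coxeter group $\Gamma$ on $k$ generators, there exist $p,q\in\mathbb{N}$ with $p+q+1=k$ and a smooth path $(\rho_t)_{t\in I}$ in $\mathrm{Hom}(\Gamma,G)$ of faithful and discrete representations into $G:=\mathrm{O}(p,q+1)$, where $I\neq\varnothing$ is an open interval, such that for any $t\neq s$ in $I$, the action of $\Gamma$ on $G$ by right-and-left multiplication via $(\rho_t,\rho_s)$ is properly discontinuous.
   Context: A right-angled Coxeter group on $k$ generators is a group $\Gamma=\Gamma_S$ with a presentation $\langle \gamma_1,\dots,\gamma_k \mid (\gamma_i\gamma_j)^{m_{i,j}}=1\ \forall i,j\rangle$, where $m_{i,i}=1$ and $m_{i,j}=m_{j,i}\in\{2,\infty\}$ for $i\neq j$ (no relation when $m_{i,j}=\infty$), $S=\{\gamma_1,\dots,\gamma_k\}$. It is irreducible if $S$ cannot be written as a disjoint union $S=S'\sqcup S''$ of two nonempty subsets such that the subgroups generated by $S'$ and $S''$ commute. $\mathbb{N}$ contains $0$. $\mathrm{O}(p,q+1)$ is the group of linear automorphisms of $\mathbb{R}^{p+q+1}$ preserving a symmetric bilinear form of signature $(p,q+1)$. A representation is faithful and discrete if it is injective with discrete image. A path $(\rho_t)$ in $\mathrm{Hom}(\Gamma,G)$ is smooth if $t\mapsto\rho_t(\gamma)$ is smooth for every $\gamma\in\Gamma$. The action of $\Gamma$ on $G$ by right-and-left multiplication via $(\rho,\rho')\in\mathrm{Hom}(\Gamma,G)^2$ is $\gamma\bullet g=\rho'(\gamma)g\rho(\gamma)^{-1}$.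 An action of a discrete group is properly discontinuous if for every compact set $\mathscr{C}$, only finitely many $\gamma$ satisfy $\gamma\bullet\mathscr{C}\cap\mathscr{C}\neq\varnothing$. *)

(* Defs.v *)
From HB Require Import structures.
From mathcomp Require Import all_boot all_order all_algebra.
From mathcomp Require Import all_classical all_reals all_analysis.
Import numFieldNormedType.Exports.

Set Implicit Arguments.
Unset Strict Implicit.
Unset Printing Implicit Defensive.

Import Order.TTheory GRing.Theory Num.Theory.
Local Open Scope classical_set_scope.
Local Open Scope ring_scope.

(* Words over the alphabet I and its formal inverses: (i, false) stands for
   the generator i and (i, true) for its inverse. *)
Definition word (I : Type) := seq (I * bool).

Definition word_val (I : Type) (G : groupType) (gen : I -> G) (w : word I) : G :=
  foldr (fun a x => ((if a.2 then (gen a.1)^-1 else gen a.1) * x)%g) 1%g w.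

(* The congruence whose quotient is the group presented by the relators rel,
   i.e. the free group on I modulo the normal closure of rel. *)
Inductive word_congr (I : Type) (rel : set (word I)) : word I -> word I -> Prop :=
| WCrefl w : word_congr rel w w
| WCsym v w : word_congr rel v w -> word_congr rel w v
| WCtrans u v w : word_congr rel u v -> word_congr rel v w -> word_congr rel u w
| WCcat v v' w w' :
    word_congr rel v v' -> word_congr rel w w' -> word_congr rel (v ++ w) (v' ++ w')
| WCinv i b : word_congr rel [:: (i, b); (i, ~~ b)] [::]
| WCrel r : rel r -> word_congr rel r [::].

Definition presented_by (I : Type) (G : groupType) (gen : I -> G)
    (rel : set (word I)) : Prop :=
  (forall x : G, exists w, x = word_val gen w) /\
  (forall w, word_val gen w = 1%g <-> word_congr rel w [::]).

(* In a Coxeter matrix, None encodes the entry infinity (no relation). *)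
Definition coxeter_relators (k : nat) (m : 'I_k -> 'I_k -> option nat) :
    set (word 'I_k) :=
  [set w | exists i j n, m i j = Some n /\
     w = flatten (nseq n [:: (i, false); (j, false)])].

Definition right_angled_matrix (k : nat) (m : 'I_k -> 'I_k -> option nat) : Prop :=
  [/\ forall i, m i i = Some 1%N,
      forall i j, m i j = m j i &
      forall i j, i != j -> m i j = Some 2%N \/ m i j = None].

Definition right_angled_coxeter (k : nat) (G : groupType) (gen : 'I_k -> G) : Prop :=
  exists m : 'I_k -> 'I_k -> option nat,
    right_angled_matrix m /\ presented_by gen (coxeter_relators m).

Definition is_subgroup (G : groupType) (H : set G) : Prop :=
  [/\ H 1%g, forall x y, H x -> H y -> H (x * y)%g & forall x, H x -> H (x^-1)%g].

Definition generated_subgroup (G : groupType) (S : set G) : set G :=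
  smallest (@is_subgroup G) S.

Definition irreducible_generators (G : groupType) (S : set G) : Prop :=
  ~ exists S' S'' : set G,
      [/\ S' !=set0, S'' !=set0, S' `&` S'' = set0, S' `|` S'' = S &
          forall x y, generated_subgroup S' x -> generated_subgroup S'' y ->
            (x * y = y * x)%g].

Definition signature_form (R : realType) (p r : nat) (u v : 'cV[R]_(p + r)) : R :=
  (u^T *m block_mx 1%:M 0 0 (- 1%:M) *m v) 0 0.

Definition orthogonal_group (R : realType) (p r : nat) : set 'M[R]_(p + r) :=
  [set g | g \in unitmx /\
     forall u v, signature_form (g *m u) (g *m v) = signature_form u v].

Definition is_representation (R : realType) (n : nat) (G : groupType)
    (O : set 'M[R]_n) (rho : G -> 'M[R]_n) : Prop :=
  (forall x, O (rho x)) /\ (forall x y, rho (x * y)%g = rho x *m rho y).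

(* Every point of A is isolated in A, i.e. the subspace topology is discrete. *)
Definition discrete_subset (T : topologicalType) (A : set T) : Prop :=
  A `<=` isolated A.

Definition faithful_discrete (R : realType) (n : nat) (G : groupType)
    (rho : G -> 'M[R]_n) : Prop :=
  injective rho /\ discrete_subset (range rho).

Definition smooth_on (R : realType) (I : set R) (f : R -> R) : Prop :=
  forall (n : nat) (t : R), I t -> derivable (derive1n n f) t 1.

Definition smooth_path (R : realType) (n : nat) (G : groupType) (I : set R)
    (rho : R -> G -> 'M[R]_n) : Prop :=
  forall (x : G) (i j : 'I_n), smooth_on I (fun t => rho t x i j).

Definition right_left_action (R : realType) (n : nat) (G : groupType)
    (rho rho' : G -> 'M[R]_n) (x : G) (g : 'M[R]_n) : 'M[R]_n :=
  rho' x *m g *m invmx (rho x).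

Definition properly_discontinuous (G : Type) (T : topologicalType) (X : set T)
    (act : G -> T -> T) : Prop :=
  forall C : set T, C `<=` X -> compact C ->
    finite_set [set x : G | (act x @` C) `&` C !=set0].

(* Main.v *)
Require Import Defs.
From HB Require Import structures.
From mathcomp Require Import all_boot all_order all_algebra.
From mathcomp Require Import all_classical all_reals all_analysis.
From mathcomp Require Import ring lra zify.
Import numFieldNormedType.Exports.
Import Order.TTheory GRing.Theory Num.Theory.
Local Open Scope classical_set_scope.
Local Open Scope ring_scope.
Set Implicit Arguments.
Unset Strict Implicit.
Unset Printing Implicit Defensive.

(** Let [A] be the 0-1 matrix recording which pairs of generators do not
    commute, and for a real [t] let [B_t = 1 - t A] be the associated Tits form.
    The reflections [v |-> v - 2 B_t(e_i, v) e_i] satisfy the Coxeter relations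
    and preserve [B_t], so they define a representation [M_t] of [Gamma] into
    the isometry group of [B_t].  The theorem holds because the size of [M_t(x)]
    grows strictly faster for larger [t], uniformly as [x] goes to infinity.

    Growth.  Put [h_t(w) = (1, ..., 1) M_t(w)].  Reading a word [w] letter by
    letter plays Mozes' numbers game on this row: the letter [i] negates the
    [i]-th entry and adds [2 t] times its old value to the entries of the
    generators that do not commute with [i].  Every element of [Gamma] has a
    word along which only positive entries are ever negated ([reduced]), and the
    negative entries are then exactly the descents.  The key observation is
    [chamber_form_fire]: the absolute values of the entries, together with the
    sums of a positive entry and a non-commuting negative one, evolve by
    [new = old + (a multiple of the fired entry)], with a multiplier among
    [0, 2t - 2, 2t - 1, 2t].  For [t >= 1] these multipliers are nonnegative, and
    replacing [t] by [s > t] multiplies them by at least [s / t].  Hence: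
    - all these quantities stay nonnegative ([chamber_form_ge0]), so [h_t(w)]
      dominates every row [u M_t(w)] ([row_word_le]), and it has a nonpositive
      entry unless [w] is empty ([reduced_height_gt0]);
    - [h_s >= (s / t)^n h_t - (s / t + 2 s N)^n] for words of length [N] and
      every [n] ([height_ratio]);
    - [h_t] is exponentially large in [N] once [t >= 3/2] ([height_growth]).
    The error term is polynomial in [N], so [|h_s| <= K |h_t|] has only finitely
    many reduced solutions, whatever [K] is ([finite_ratio_le]).

    Conclusion.  If [x] moves a point of a compact subset [C] of the orthogonal
    group to a point of [C], then [M_s(x)] and [M_t(x)] are obtained from each
    other by multiplication on both sides by matrices from a bounded set, so
    their sizes are comparable and [x] lies in a finite set.  Faithfulness and
    discreteness hold because [M_t(x)] near the identity makes all entries of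
    [h_t] positive, which forces [x = 1].

    Smoothness.  The forms [- B_t] must be brought to the standard diagonal
    form by a change of basis that is smooth in [t].  Completing squares does
    it, by induction on the size ([smooth_splitting]); at each step the interval
    of parameters is shrunk so that the next pivot keeps a constant sign, which
    is possible because [det (1 - t A)] is a nonzero polynomial in [t].  Taking
    [- B_t] rather than [B_t] guarantees a negative direction, since
    [B_t(e_i, e_i) = 1]. *)

(** * Smooth functions of one real variable and smooth matrices *)

Section Smooth.
Context {R : realType}.
Implicit Types (U : set R) (f g : R -> R) (n : nat).

(** Derivability up to order [n] on [U].  The derivative is any function [g] that
    has the right values on [U]: the iterated derivatives of a product or of a
    square root then need not be known outside [U]. *)
Fixpoint diff_upto n U f : Prop :=
  if n is m.+1 then
    exists2 g, diff_upto m U g & forall t, U t -> is_derive t (1 : R) f (g t)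
  else True.

Definition smooth U f := forall n, diff_upto n U f.

Lemma diff_uptoW n U f : diff_upto n.+1 U f -> diff_upto n U f.
Proof.
elim: n f => [//|n IHn] f [g gU fg].
by exists g => //; exact: IHn.
Qed.

Lemma diff_uptoS n U V f : V `<=` U -> diff_upto n U f -> diff_upto n V f.
Proof.
move=> VU; elim: n f => [//|n IHn] f [g /IHn gV fg].
by exists g => // t /VU; exact: fg.
Qed.

Lemma smoothS U V f : V `<=` U -> smooth U f -> smooth V f.
Proof. by move=> VU fU n; exact: diff_uptoS (fU n). Qed.

Lemma eq_smooth U f g : open U -> (forall t, U t -> f t = g t) ->
  smooth U f -> smooth U g.
Proof.
move=> oU fg fU [//|n]; have [h hU fh] := fU n.+1.
exists h => // t Ut; apply: near_eq_is_derive (fh t Ut).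
by near=> s; apply: fg; near: s; exact: open_nbhs_nbhs.
Unshelve. all: by end_near. Qed.

Lemma derive1n_eq U f g n : open U -> (forall t, U t -> f t = g t) ->
  forall t, U t -> derive1n n f t = derive1n n g t.
Proof.
move=> oU fg; elim: n => [//|n IHn] t Ut.
rewrite !derive1nS !derive1E; apply: near_eq_derive.
by near=> s; apply: IHn; near: s; exact: open_nbhs_nbhs.
Unshelve. all: by end_near. Qed.

Lemma smooth_smooth_on U f : open U -> smooth U f -> smooth_on U f.
Proof.
move=> oU fU n t Ut; move: (fU n.+1) => {fU}.
elim: n f => [|n IHn] f [g gU fg]; first by have [] := fg t Ut.
have := IHn g gU; rewrite derive1Sn; apply: near_eq_derivable.
near=> s; apply: (@derive1n_eq U) => //; last first.
  by near: s; exact: open_nbhs_nbhs.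
by move=> r Ur; rewrite derive1E; have [_ ->] := fg r Ur.
Unshelve. all: by end_near. Qed.

Lemma smooth_continuous U f t : smooth U f -> U t -> {for t, continuous f}.
Proof.
move=> /(_ 1%N)[g _ fg] Ut; apply: differentiable_continuous.
by apply/derivable1_diffP; have [] := fg t Ut.
Qed.

Lemma smooth_cst U (a : R) : smooth U (fun=> a).
Proof.
move=> n; elim: n a => [//|n IHn] a; exists (fun=> 0) => // t _.
exact: is_derive_cst.
Qed.

Lemma smooth_id U : smooth U id.
Proof.
case=> [//|n]; exists (fun=> 1) => [|t _]; first exact: (smooth_cst _ _ _).
exact: is_derive_id.
Qed.

Lemma diff_uptoD n U f g :
  diff_upto n U f -> diff_upto n U g -> diff_upto n U (fun t => f t + g t).
Proof.
elim: n f g => [//|n IHn] f g [f' f'U ff'] [g' g'U gg'].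
exists (fun t => f' t + g' t); first exact: IHn.
by move=> t Ut; apply: is_deriveD; [exact: ff'|exact: gg'].
Qed.

Lemma diff_uptoM n U f g :
  diff_upto n U f -> diff_upto n U g -> diff_upto n U (fun t => f t * g t).
Proof.
elim: n f g => [//|n IHn] f g fU gU.
have [f' f'U ff'] := fU; have [g' g'U gg'] := gU.
exists (fun t => f t * g' t + g t * f' t).
  by apply: diff_uptoD; apply: IHn => //; exact: diff_uptoW.
by move=> t Ut; apply: is_deriveM; [exact: ff'|exact: gg'].
Qed.

Lemma diff_uptoV n U f : (forall t, U t -> f t != 0) ->
  diff_upto n U f -> diff_upto n U (fun t => (f t)^-1).
Proof.
move=> f0; elim: n => [//|n IHn] fU; have [f' f'U ff'] := fU.
have gU := IHn (diff_uptoW fU).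
exists (fun t => -1 * ((f t)^-1 * (f t)^-1) * f' t).
  do 2 apply: diff_uptoM => //; last exact: diff_uptoM.
  exact: (smooth_cst _ _ _).
move=> t Ut; have := is_deriveV (f0 t Ut) (ff' t Ut).
by rewrite mulN1r -expr2 exprVn.
Qed.

Lemma diff_upto_sqrt n U f : (forall t, U t -> 0 < f t) ->
  diff_upto n U f -> diff_upto n U (fun t => Num.sqrt (f t)).
Proof.
move=> f0; elim: n => [//|n IHn] fU; have [f' f'U ff'] := fU.
have gU := IHn (diff_uptoW fU).
exists (fun t => (2 * Num.sqrt (f t))^-1 * f' t).
  apply: diff_uptoM => //; apply: diff_uptoV.
    by move=> t Ut; rewrite mulf_neq0 ?pnatr_eq0// gt_eqF// sqrtr_gt0 f0.
  by apply: diff_uptoM => //; exact: (smooth_cst _ _ _).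
move=> t Ut; exact: (is_derive1_comp (is_derive1_sqrt (f0 t Ut)) (ff' t Ut)).
Qed.

Lemma smoothD U f g : smooth U f -> smooth U g -> smooth U (fun t => f t + g t).
Proof. by move=> fU gU n; exact: diff_uptoD. Qed.

Lemma smoothM U f g : smooth U f -> smooth U g -> smooth U (fun t => f t * g t).
Proof. by move=> fU gU n; exact: diff_uptoM. Qed.

Lemma smoothV U f : (forall t, U t -> f t != 0) ->
  smooth U f -> smooth U (fun t => (f t)^-1).
Proof. by move=> f0 fU n; exact: diff_uptoV. Qed.

Lemma smooth_sqrt U f : (forall t, U t -> 0 < f t) ->
  smooth U f -> smooth U (fun t => Num.sqrt (f t)).
Proof. by move=> f0 fU n; exact: diff_upto_sqrt. Qed.

Lemma smoothN U f : smooth U f -> smooth U (fun t => - f t).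
Proof.
move=> fU; rewrite (_ : (fun _ => _) = fun t => -1 * f t); last first.
  by apply/funext => t; rewrite mulN1r.
by apply: smoothM => //; exact: smooth_cst.
Qed.

Lemma smooth_sum U (J : Type) (r : seq J) (P : pred J) (F : J -> R -> R) :
  (forall j, P j -> smooth U (F j)) -> smooth U (fun t => \sum_(j <- r | P j) F j t).
Proof.
move=> FU; elim: r => [|j r IHr].
  by under eq_fun do rewrite big_nil; exact: smooth_cst.
under eq_fun do rewrite big_cons.
by case Pj: (P j) => //; apply: smoothD => //; exact: FU.
Qed.

Lemma smooth_prod U (J : Type) (r : seq J) (P : pred J) (F : J -> R -> R) :
  (forall j, P j -> smooth U (F j)) -> smooth U (fun t => \prod_(j <- r | P j) F j t).
Proof.
move=> FU; elim: r => [|j r IHr].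
  by under eq_fun do rewrite big_nil; exact: smooth_cst.
under eq_fun do rewrite big_cons.
by case Pj: (P j) => //; apply: smoothM => //; exact: FU.
Qed.

Definition smooth_mx U m n (F : R -> 'M[R]_(m, n)) :=
  forall i j, smooth U (fun t => F t i j).

Lemma smooth_mxS U V m n (F : R -> 'M[R]_(m, n)) :
  V `<=` U -> smooth_mx U F -> smooth_mx V F.
Proof. by move=> VU FU i j; exact: smoothS (FU i j). Qed.

Lemma smooth_mx_cst U m n (A : 'M[R]_(m, n)) : smooth_mx U (fun=> A).
Proof. by move=> i j; exact: smooth_cst. Qed.

Lemma smooth_mx_scalar U n f : smooth U f ->
  smooth_mx U (fun t => (f t)%:M : 'M[R]_n).
Proof.
move=> fU i j; rewrite (_ : (fun _ => _) = fun t => f t *+ (i == j)).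
  by case: eqP => _; [exact: fU|exact: smooth_cst].
by apply/funext => t; rewrite mxE.
Qed.

Lemma smooth_mxD U m n (F G : R -> 'M[R]_(m, n)) :
  smooth_mx U F -> smooth_mx U G -> smooth_mx U (fun t => F t + G t).
Proof.
by move=> FU GU i j; under eq_fun do rewrite mxE; exact: smoothD.
Qed.

Lemma smooth_mxN U m n (F : R -> 'M[R]_(m, n)) :
  smooth_mx U F -> smooth_mx U (fun t => - F t).
Proof. by move=> FU i j; under eq_fun do rewrite mxE; exact: smoothN. Qed.

Lemma smooth_mxZ U m n f (F : R -> 'M[R]_(m, n)) :
  smooth U f -> smooth_mx U F -> smooth_mx U (fun t => f t *: F t).
Proof.
by move=> fU FU i j; under eq_fun do rewrite mxE; exact: smoothM.
Qed.

Lemma smooth_mxM U m n p (F : R -> 'M[R]_(m, n)) (G : R -> 'M[R]_(n, p)) :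
  smooth_mx U F -> smooth_mx U G -> smooth_mx U (fun t => F t *m G t).
Proof.
move=> FU GU i j; under eq_fun do rewrite mxE.
by apply: smooth_sum => l _; exact: smoothM.
Qed.

Lemma smooth_mxT U m n (F : R -> 'M[R]_(m, n)) :
  smooth_mx U F -> smooth_mx U (fun t => (F t)^T).
Proof. by move=> FU i j; under eq_fun do rewrite mxE; exact: FU. Qed.

Lemma smooth_row_mx U m n1 n2 (F : R -> 'M[R]_(m, n1)) (G : R -> 'M[R]_(m, n2)) :
  smooth_mx U F -> smooth_mx U G -> smooth_mx U (fun t => row_mx (F t) (G t)).
Proof.
move=> FU GU i j; under eq_fun do rewrite mxE.
by case: splitP => l _; [exact: FU|exact: GU].
Qed.

Lemma smooth_col_mx U m1 m2 n (F : R -> 'M[R]_(m1, n)) (G : R -> 'M[R]_(m2, n)) :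
  smooth_mx U F -> smooth_mx U G -> smooth_mx U (fun t => col_mx (F t) (G t)).
Proof.
move=> FU GU i j; under eq_fun do rewrite mxE.
by case: splitP => l _; [exact: FU|exact: GU].
Qed.

Lemma smooth_det U n (F : R -> 'M[R]_n) :
  smooth_mx U F -> smooth U (fun t => \det (F t)).
Proof.
move=> FU; apply: smooth_sum => s _; apply: smoothM; first exact: smooth_cst.
by apply: smooth_prod => i _; exact: FU.
Qed.

Lemma smooth_mx_inv U n (F : R -> 'M[R]_n) : open U ->
  (forall t, U t -> F t \in unitmx) -> smooth_mx U F ->
  smooth_mx U (fun t => invmx (F t)).
Proof.
move=> oU Fu FU i j; pose G t := (\det (F t))^-1 * cofactor (F t) j i.
have : smooth U G.
  apply: smoothM.
    apply: smoothV; last exact: smooth_det.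
    by move=> t /Fu; rewrite unitmxE unitfE.
  apply: smoothM; first exact: smooth_cst.
  apply: smooth_det => a b; under eq_fun do rewrite !mxE; exact: FU.
apply: eq_smooth => // t Ut.
by rewrite /G /invmx (Fu _ Ut) !mxE.
Qed.

End Smooth.

(** * Smooth diagonalisation of a symmetric pencil *)

Section Pencil.
Context {R : realType}.

Lemma exists_nonroot (p : {poly R}) (a b : R) : p != 0 -> a < b ->
  exists2 t, t \in `]a, b[ & ~~ root p t.
Proof.
move=> p0 ab; pose x i := a + (b - a) / i.+2%:R.
have ba0 : 0 < b - a by rewrite subr_gt0.
have x_inj : injective x.
  move=> i j /addrI /(mulfI (lt0r_neq0 ba0)) /invr_inj /eqP.
  by rewrite eqr_nat => /eqP[].
have [/(max_poly_roots p0)|/allPn[_ /mapP[i _ ->] xr]] :=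
    boolP (all (root p) (map x (iota 0 (size p)))).
  by rewrite map_inj_uniq// iota_uniq size_map size_iota ltnn => /(_ isT).
exists (x i) => //; rewrite in_itv/= /x ltrDl divr_gt0//=.
rewrite -ltrBrDl ltr_pdivrMr// ltr_pMr//.
by rewrite (ltr_nat R 1).
Qed.

(** [det (1 - t A)] is a polynomial in [t] with value 1 at [t = 0]. *)
Lemma exists_unit_pencil m (A : 'M[R]_m) (a b : R) : a < b ->
  exists2 t, t \in `]a, b[ & 1%:M - t *: A \in unitmx.
Proof.
move=> ab; pose Q : 'M[{poly R}]_m := 1%:M - 'X *: map_mx polyC A.
have QE t : (\det Q).[t] = \det (1%:M - t *: A).
  rewrite -horner_evalE -det_map_mx; congr (\det _).
  apply/matrixP => i j; rewrite !mxE /= horner_evalE !hornerE.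
  by case: (i == j); rewrite !hornerE.
have [|t tab tQ] := @exists_nonroot (\det Q) a b _ ab.
  apply: contra_neq (@oner_neq0 R) => Q0.
  by rewrite -(@det1 _ m) -[1%:M]subr0 -(scale0r A) -QE Q0 hornerE.
by exists t => //; rewrite unitmxE unitfE -QE.
Qed.

(** Smooth diagonalisation of the symmetric pencil [1 - t A].  With [C] the
    lower right block, completing the square gives
    [1 - t A = L^T C L + dl e_0 e_0^T], where [L = (u^T, 1)] clears the first row
    and [dl] is the Schur complement of [C].  The splitting of [C] is transported
    by [L], and the square root of the absolute value of [dl] is added to the
    positive or to the negative part according to the sign of [dl]. *)
Lemma smooth_splitting m (A : 'M[R]_m) (a b : R) : A^T = A -> a < b ->
  exists c d, [/\ c < d, {subset `]c, d[ <= `]a, b[} &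
  exists p r (P : R -> 'M[R]_(p, m)) (N : R -> 'M[R]_(r, m)),
  [/\ (p + r)%N = m, smooth_mx [set` `]c, d[] P, smooth_mx [set` `]c, d[] N &
  forall t, t \in `]c, d[ -> 1%:M - t *: A \in unitmx /\
     1%:M - t *: A = (P t)^T *m P t - (N t)^T *m N t]].
Proof.
elim: m A a b => [|m IHm] A a b AT ab.
  exists a, b; split=> //; exists 0%N, 0%N, (fun=> 0), (fun=> 0).
  split=> //; try exact: smooth_mx_cst.
  by move=> t _; rewrite [_ - _]flatmx0 [RHS]flatmx0 -(flatmx0 1%:M) unitmx1.
rewrite -[m.+1]/(1 + m)%N in A AT *.
have [||c0 [d0 [cd0 sub0 [p [r [P [N [pr Ps Ns PN]]]]]]]] := IHm (drsubmx A) a b.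
- by rewrite -[in RHS]AT trmx_drsub.
- by [].
have [t0 t0cd t0u] := exists_unit_pencil A cd0.
pose U0 := [set` `]c0, d0[].
pose C t := 1%:M - t *: drsubmx A.
pose u t := (- t) *: (ursubmx A *m invmx (C t)).
pose L t := row_mx (u t)^T 1%:M.
pose dl t := (1%:M - t *: ulsubmx A - u t *m C t *m (u t)^T) 0 0.
have idE m1 : smooth_mx U0 (fun=> 1%:M : 'M[R]_m1) by exact: smooth_mx_cst.
have pencil_smooth m1 (A1 : 'M[R]_m1) : smooth_mx U0 (fun t => 1%:M - t *: A1).
  apply: smooth_mxD => //; apply: smooth_mxN; apply: smooth_mxZ.
    exact: smooth_id.
  exact: smooth_mx_cst.
have Cs : smooth_mx U0 C by exact: pencil_smooth.
have us : smooth_mx U0 u.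
  apply: smooth_mxZ; first by apply: smoothN; exact: smooth_id.
  apply: smooth_mxM; first exact: smooth_mx_cst.
  apply: smooth_mx_inv => //.
  by move=> t tU; have [] := PN t tU.
have Ls : smooth_mx U0 L by apply: smooth_row_mx => //; exact: smooth_mxT.
have dls : smooth U0 dl.
  rewrite /dl; apply: (smooth_mxD (G := fun t => - (u t *m C t *m (u t)^T)) _ _ 0 0).
    exact: pencil_smooth.
  apply: smooth_mxN; apply: smooth_mxM; last exact: smooth_mxT.
  exact: smooth_mxM.
have AE t : t \in `]c0, d0[ ->
    1%:M - t *: A = (L t)^T *m C t *m L t + block_mx (dl t)%:M 0 0 0.
  move=> tcd; have [Cu _] := PN t tcd.
  have uC : u t *m C t = - t *: ursubmx A by rewrite -scalemxAl mulmxKV.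
  have CT : (C t)^T = C t.
    by rewrite /C linearB/= linearZ/= trmx1 trmx_drsub AT.
  have Cu' : C t *m (u t)^T = - t *: dlsubmx A.
    by rewrite -[C t]CT -trmx_mul uC linearZ/= trmx_ursub AT.
  rewrite /L tr_row_mx trmxK trmx1 mul_col_mx mul_col_row uC mul1mx Cu' !mulmx1.
  rewrite add_block_mx !addr0 -{1}[A]submxK -uC.
  rewrite (_ : (dl t)%:M = 1%:M - t *: ulsubmx A - u t *m C t *m (u t)^T); last first.
    by rewrite [RHS]mx11_scalar.
  rewrite addrCA subrr addr0 uC (@scalar_mx_block _ 1 m) scale_block_mx.
  by rewrite opp_block_mx add_block_mx !add0r !scaleNr.
(* A vanishing Schur complement would make the kernel of [L t0] part of the
   kernel of the pencil. *)
have dl0 : dl t0 != 0.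
  apply/eqP => d0E; pose z : 'cV[R]_(1 + m) := col_mx 1%:M (- (u t0)^T).
  have Az : (1%:M - t0 *: A) *m z = 0.
    rewrite AE// d0E -scalemx1 scale0r block_mx0 addr0 -!mulmxA.
    by rewrite /L /z mul_row_col mul1mx mulmx1 subrr !mulmx0.
  have := mulKmx t0u z; rewrite Az mulmx0 => /matrixP/(_ (lshift m 0) 0).
  rewrite col_mxEu !mxE eqxx => /eqP.
  by rewrite eq_sym oner_eq0.
clearbody L dl.
have dets : smooth U0 (fun t => \det (1%:M - t *: A)).
  by apply: smooth_det; exact: pencil_smooth.
have : \forall t \near t0, [/\ t \in `]c0, d0[, 0 < dl t0 * dl t &
    1%:M - t *: A \in unitmx].
  have nU : \forall t \near t0, t \in `]c0, d0[.
    by apply: open_nbhs_nbhs; split; [exact: interval_open|exact: t0cd].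
  have n1 : \forall t \near t0, 0 < dl t0 * dl t.
    have dl2 : dl t0 * dl t @[t --> t0] --> dl t0 * dl t0.
      by apply: cvgMl_tmp; exact: (smooth_continuous dls).
    by apply: (cvgr_gt _ dl2); rewrite -expr2 exprn_even_gt0.
  have n2 : \forall t \near t0, \det (1%:M - t *: A) != 0.
    have detc : \det (1%:M - t *: A) @[t --> t0] --> \det (1%:M - t0 *: A).
      exact: (smooth_continuous dets).
    by apply: (cvgr_neq0 _ detc); rewrite -unitfE -unitmxE.
  near=> t; split; near: t => //.
  by near=> t; rewrite unitmxE unitfE; near: t.
case/nbhs_ballP => e /= e0 ballP.
have cdP t : t \in `]t0 - e, t0 + e[ -> [/\ t \in `]c0, d0[, 0 < dl t0 * dl t &
    1%:M - t *: A \in unitmx].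
  by move=> tcd; apply: ballP; rewrite ball_itv/=.
have subU : [set` `]t0 - e, t0 + e[] `<=` U0 by move=> t /cdP[].
exists (t0 - e), (t0 + e); split.
- by rewrite ltrD2l gtrN.
- by move=> t /cdP[/sub0].
have [dpos|dneg] := ltP 0 (dl t0).
  have dlt t : t \in `]t0 - e, t0 + e[ -> 0 < dl t by case/cdP; rewrite pmulr_rgt0.
  exists (1 + p)%N, r,
    (fun t => col_mx (row_mx (Num.sqrt (dl t))%:M 0) (P t *m L t)), (fun t => N t *m L t).
  split.
  - by rewrite -addnA pr.
  - apply: smooth_col_mx; last by apply: smooth_mxS subU _; exact: smooth_mxM.
    apply: smooth_row_mx; last exact: smooth_mx_cst.
    by apply: smooth_mx_scalar; apply: smooth_sqrt => //; exact: smoothS dls.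
  - by apply: smooth_mxS subU _; exact: smooth_mxM.
  move=> t tcd; have [tU _ tu] := cdP t tcd; split=> //.
  rewrite AE// tr_col_mx mul_row_col tr_row_mx mul_col_row !trmx_mul -!mulmxA.
  rewrite !(mulmxA _ _ (L t)) -addrA -mulmxBl -mulmxBr; have [_ <-] := PN t tU.
  rewrite addrC; congr (_ + _); rewrite trmx0 !mulmx0 mul0mx.
  by rewrite tr_scalar_mx -scalar_mxM -expr2 sqr_sqrtr// ltW// dlt.
have {dl0}dneg : dl t0 < 0 by rewrite lt_neqAle dl0.
have dlt t : t \in `]t0 - e, t0 + e[ -> 0 < - dl t.
  by case/cdP; rewrite nmulr_rgt0// oppr_gt0.
exists p, (1 + r)%N, (fun t => P t *m L t),
  (fun t => col_mx (row_mx (Num.sqrt (- dl t))%:M 0) (N t *m L t)).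
split.
- by rewrite addnCA pr.
- by apply: smooth_mxS subU _; exact: smooth_mxM.
- apply: smooth_col_mx; last by apply: smooth_mxS subU _; exact: smooth_mxM.
  apply: smooth_row_mx; last exact: smooth_mx_cst.
  by apply: smooth_mx_scalar; apply: smooth_sqrt => //; apply: smoothN; exact: smoothS dls.
move=> t tcd; have [tU _ tu] := cdP t tcd; split=> //.
rewrite AE// tr_col_mx mul_row_col tr_row_mx mul_col_row !trmx_mul -!mulmxA.
rewrite !(mulmxA _ _ (L t)) opprD addrCA -mulmxBl -mulmxBr; have [_ <-] := PN t tU.
rewrite addrC; congr (_ + _); rewrite trmx0 !mulmx0 mul0mx.
rewrite tr_scalar_mx -scalar_mxM -expr2 sqr_sqrtr ?ltW ?dlt//.
by rewrite opp_block_mx !oppr0 raddfN/= opprK.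
Unshelve. all: by end_near. Qed.

End Pencil.

(** * Counting letters, exponentials against powers *)

Section Asymptotics.
Context {R : realType}.
Lemma exists_expr_ge (x K : R) : 1 < x -> exists n, K <= x ^+ n.
Proof.
move=> x1; have bern n : 1 + n%:R * (x - 1) <= x ^+ n.
  elim: n => [|n IHn]; first by rewrite mul0r addr0.
  have n0 : 0 <= n%:R :> R by [].
  rewrite exprS -natr1; have x0 : 0 <= x by lra.
  apply: le_trans (ler_wpM2l x0 IHn); rewrite -subr_ge0.
  have -> : x * (1 + n%:R * (x - 1)) - (1 + (n%:R + 1) * (x - 1)) =
    n%:R * (x - 1) ^+ 2 by ring.
  by rewrite mulr_ge0// sqr_ge0.
exists (Num.truncn (K / (x - 1))).+1; apply: le_trans (bern _).
have := truncnS_gt (K / (x - 1)); rewrite ltr_pdivrMr ?subr_gt0// => /ltW h.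
by lra.
Qed.

(** Exponentials beat powers: with [d = m / (n + 1)], [m <= (n + 1) 2^d] and
    [(2^d)^(n + 1) <= 2^m]. *)
Lemma expn_le_pow2 m n : (m ^ n.+1 <= n.+1 ^ n.+1 * 2 ^ m)%N.
Proof.
have h : (m <= n.+1 * 2 ^ (m %/ n.+1))%N.
  rewrite [X in (X <= _)%N](divn_eq m n.+1); set d := (m %/ n.+1)%N.
  have := ltn_pmod m (ltn0Sn n); have := ltn_expl d (ltnSn 1); nia.
apply: (@leq_trans ((n.+1 * 2 ^ (m %/ n.+1)) ^ n.+1)); first by rewrite leq_exp2r.
rewrite expnMn leq_mul2l -expnM leq_exp2l// leq_divM orbT//.
Qed.

Lemma size_le_count (T : finType) (w : seq T) : (0 < size w)%N ->
  exists i, (size w <= #|T| * count_mem i w)%N.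
Proof.
move=> w0; have [x _] : exists x, x \in w.
  by case: w w0 => [//|x w] _; exists x; rewrite mem_head.
have sizeE : (size w = \sum_i count_mem i w)%N.
  elim: w {w0} => [|y w IHw] /=; first by rewrite big1.
  rewrite big_split /= -IHw (bigD1 y)//= eqxx big1 ?addn0// => z zy.
  by rewrite eq_sym (negPf zy).
have T0 : (0 < #|T|)%N by apply/card_gt0P; exists x.
have [i iE] := bigop.eq_bigmax (fun i => count_mem i w) T0.
exists i; rewrite -iE {1}sizeE -sum_nat_const.
by apply: leq_sum => j _; exact: bigop.leq_bigmax.
Qed.

Lemma finite_words (T : finType) N : finite_set [set w : seq T | (size w <= N)%N].
Proof.
apply: (@sub_finite_set _ _ [set bseqval s | s in [set: N.-bseq T]]).
  by move=> w wN; exists (Bseq wN).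
by apply: finite_image; exact: finite_finset.
Qed.
End Asymptotics.

(** * An entrywise matrix norm *)

Section Norm1.
Context {R : realType}.

Definition norm1 m n (A : 'M[R]_(m, n)) := \sum_i \sum_j `|A i j|.

Lemma norm1_ge0 m n (A : 'M[R]_(m, n)) : 0 <= norm1 A.
Proof. by apply: sumr_ge0 => i _; apply: sumr_ge0. Qed.

Lemma norm1M m n p (A : 'M[R]_(m, n)) (B : 'M[R]_(n, p)) :
  norm1 (A *m B) <= norm1 A * norm1 B.
Proof.
rewrite /norm1 mulr_suml; apply: ler_sum => i _.
apply: (@le_trans _ _ (\sum_j \sum_l `|A i l| * `|B l j|)).
  apply: ler_sum => j _; rewrite mxE.
  by apply: le_trans (ler_norm_sum _ _ _) _; apply: ler_sum => l _; rewrite normrM.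
rewrite exchange_big mulr_suml /=; apply: ler_sum => l _.
rewrite -mulr_sumr ler_wpM2l// (bigD1 l)//= lerDl.
by apply: sumr_ge0 => ? _; apply: sumr_ge0.
Qed.

Lemma ler_norm1 m n (A : 'M[R]_(m, n)) i j : `|A i j| <= norm1 A.
Proof.
rewrite /norm1 (bigD1 i)//= (bigD1 j)//= -addrA lerDl addr_ge0 ?sumr_ge0//.
by move=> ? _; apply: sumr_ge0.
Qed.

Lemma norm1_row n (a : 'rV[R]_n) : norm1 a = \sum_j `|a 0 j|.
Proof. by rewrite /norm1 big_ord1. Qed.

End Norm1.

(** * The numbers game of the Tits representation *)

Section Game.
Context {R : realType} (k : nat) (c : rel 'I_k).
Hypotheses (c_sym : symmetric c) (c_irr : irreflexive c).
Implicit Types (t s : R) (i j l : 'I_k) (w : seq 'I_k) (D : {set 'I_k}).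
Implicit Types (a : 'rV[R]_k) (q : 'rV[R]_k -> R).

Definition adjacency : 'M[R]_k := \matrix_(i, j) (c i j)%:R.

Definition tits_form t : 'M[R]_k := 1%:M - t *: adjacency.

Definition tits_refl t i : 'M[R]_k :=
  1%:M - 2 *: (delta_mx i i *m tits_form t).

Definition word_mx t w : 'M[R]_k :=
  foldr (fun i M => tits_refl t i *m M) 1%:M w.

Lemma adjacencyT : adjacency^T = adjacency.
Proof. by apply/matrixP => i j; rewrite !mxE c_sym. Qed.

Lemma tits_formT t : (tits_form t)^T = tits_form t.
Proof. by rewrite /tits_form linearB/= trmx1 linearZ/= adjacencyT. Qed.

Lemma tits_form_diag t i : tits_form t i i = 1.
Proof. by rewrite !mxE c_irr eqxx mulr0 subr0. Qed.

Lemma delta_form_delta t i j :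
  delta_mx i i *m tits_form t *m delta_mx j j = tits_form t i j *: delta_mx i j.
Proof.
apply/matrixP => x y; rewrite !mxE (bigD1 j)//= big1 ?addr0; last first.
  by move=> z zj; rewrite [delta_mx j j _ _]mxE (negPf zj) mulr0.
rewrite mxE (bigD1 i)//= big1 ?addr0; last first.
  by move=> z zi; rewrite mxE (negPf zi) andbF mul0r.
rewrite !mxE !eqxx andbT mulrC mulrA mulrC; congr (_ * _).
by case: (x == i); case: (y == j); rewrite ?mulr0 ?mulr1 ?mul0r ?mul1r.
Qed.

Lemma tits_refl_invol t i : tits_refl t i *m tits_refl t i = 1%:M.
Proof.
rewrite /tits_refl; set X := delta_mx i i *m _.
have XX : X *m X = X.
  by rewrite /X mulmxA delta_form_delta tits_form_diag scale1r.
rewrite mulmxBl mul1mx mulmxBr mulmx1 -scalemxAl -scalemxAr XX.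
by apply/matrixP => x y; rewrite !mxE; ring.
Qed.

Lemma tits_refl_comm t i j : i != j -> ~~ c i j ->
  tits_refl t i *m tits_refl t j = tits_refl t j *m tits_refl t i.
Proof.
move=> ij cij; rewrite /tits_refl.
have XY x y : x != y -> ~~ c x y ->
    (delta_mx x x *m tits_form t) *m (delta_mx y y *m tits_form t) = 0.
  move=> xy cxy; rewrite mulmxA delta_form_delta !mxE (negPf xy) (negPf cxy).
  by rewrite mulr0 subr0 scale0r mul0mx.
have XY0 := XY i j ij cij; have := XY j i; rewrite eq_sym c_sym => /(_ ij cij).
move: (delta_mx i i *m _) (delta_mx j j *m _) XY0 => X Y XY0 YX0.
rewrite !mulmxBl !mul1mx !mulmxBr !mulmx1 -!scalemxAl -!scalemxAr XY0 YX0.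
by rewrite !scaler0 !subr0 -!addrA [X in _ + X]addrC.
Qed.

Lemma tits_refl_form t i :
  (tits_refl t i)^T *m tits_form t *m tits_refl t i = tits_form t.
Proof.
rewrite /tits_refl [(_ - _)^T]linearB/= trmx1 [(2 *: _)^T]linearZ/= trmx_mul.
rewrite trmx_delta tits_formT.
have := delta_form_delta t i i; rewrite tits_form_diag scale1r.
move: (tits_form t) (delta_mx i i) => B E EBE.
rewrite mulmxBl mul1mx -scalemxAl mulmxBr mulmx1 -scalemxAr mulmxBl -scalemxAl.
rewrite -[B *m E *m B *m _]mulmxA -[B *m E *m (B *m _)]mulmxA.
rewrite [E *m (B *m _)]mulmxA [E *m B *m (E *m _)]mulmxA EBE !mulmxA.
by apply/matrixP => x y; rewrite !mxE; ring.
Qed.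

Lemma word_mx_cat t w1 w2 : word_mx t (w1 ++ w2) = word_mx t w1 *m word_mx t w2.
Proof. by elim: w1 => [|i w1 IH] /=; rewrite ?mul1mx// IH mulmxA. Qed.

Lemma word_mx_rcons t w i : word_mx t (rcons w i) = word_mx t w *m tits_refl t i.
Proof. by rewrite -cats1 word_mx_cat /= mulmx1. Qed.

Lemma row_tits_refl t a i l : (a *m tits_refl t i) 0 l =
  if l == i then - a 0 i else a 0 l + 2 * t * (c i l)%:R * a 0 i.
Proof.
rewrite mulmxBr mulmx1 -scalemxAr mulmxA.
have -> : a *m delta_mx i i = a 0 i *: delta_mx 0 i.
  apply/rowP => j; rewrite !mxE (bigD1 i)//= big1 ?addr0; last first.
    by move=> z zi; rewrite mxE (negPf zi) mulr0.
  by rewrite !mxE !eqxx.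
rewrite -scalemxAl -rowE !mxE.
case: (eqVneq l i) => [->|li]; rewrite ?eqxx ?c_irr /=; first by ring.
by ring.
Qed.

(** The letter [i] becomes a descent, and cancels the descents that do not
    commute with it. *)
Definition fire_descents i D := i |: (D :\: [set l | c i l]).

(** Words of the right-angled Coxeter group paired with their right descents; a
    letter may only be appended when it is not a descent already.  [D] depends on
    the word alone, so that the same [D] describes the signs of the row
    [height_row t w] for all [t >= 1] at once. *)
Inductive reduced : seq 'I_k -> {set 'I_k} -> Prop :=
| reduced_nil : reduced [::] finset.set0
| reduced_rcons w D i : reduced w D -> i \notin D ->
    reduced (rcons w i) (fire_descents i D).

(** The linear forms that are nonnegative along reduced words.  The pairs are what
    makes the family closed under firing: when [i] fires, a neighbouring negative
    entry [a_l] turns into [2 t a_i + a_l = (a_i + a_l) + (2 t - 1) a_i]. *)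
Inductive chamber_form D : ('rV[R]_k -> R) -> Prop :=
| form_pos i : i \notin D -> chamber_form D (fun a => a 0 i)
| form_neg i : i \in D -> chamber_form D (fun a => - a 0 i)
| form_pair i j : j \in D -> c j i -> chamber_form D (fun a => a 0 i + a 0 j).

(** Every form of the new chamber, evaluated after firing [i], is a form of the old
    chamber plus a multiple of the fired entry.  The multiplier is [0] or
    [2 t - d] with [d <= 2]; neither [q0], [b] nor [d] depends on [t], which
    permits comparing two parameters along the same word. *)
Lemma chamber_form_fire D i q : i \notin D -> chamber_form (fire_descents i D) q ->
  exists q0 (b : bool) (d : nat), [/\ chamber_form D q0, (d <= 2)%N &
    forall t a, q (a *m tits_refl t i) = q0 a + b%:R * (2 * t - d%:R) * a 0 i].
Proof.
move=> iD [l|l|l j]; rewrite /fire_descents !inE.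
- rewrite negb_or negb_and negbK => /andP[li /orP[cil|lD]].
    have [lD|lD] := boolP (l \in D).
      exists (fun a => a 0 i + a 0 l), true, 1%N; split=> //.
        by apply: form_pair; rewrite 1?c_sym.
      by move=> t a; rewrite row_tits_refl (negPf li) cil /=; ring.
    exists (fun a => a 0 l), true, 0%N; split=> //; first exact: form_pos.
    by move=> t a; rewrite row_tits_refl (negPf li) cil /=; ring.
  exists (fun a => a 0 l), (c i l), 0%N; split=> //; first exact: form_pos.
  by move=> t a; rewrite row_tits_refl (negPf li) /=; ring.
- move=> /orP[/eqP ->|/andP[cil lD]].
    exists (fun a => a 0 i), false, 0%N; split=> //; first exact: form_pos.
    by move=> t a; rewrite row_tits_refl eqxx /=; ring.
  exists (fun a => - a 0 l), false, 0%N; split=> //; first exact: form_neg.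
  move=> t a; rewrite row_tits_refl (negPf cil).
  by case: eqP lD iD => [-> ->//|_ _ _] /=; ring.
- move=> /orP[/eqP -> cil|/andP[cij jD] cjl].
    have li : (l == i) = false by apply: contraTF cil => /eqP ->; rewrite c_irr.
    have [lD|lD] := boolP (l \in D).
      exists (fun a => a 0 i + a 0 l), true, 2%N; split=> //.
        by apply: form_pair; rewrite 1?c_sym.
      by move=> t a; rewrite !row_tits_refl eqxx li cil /=; ring.
    exists (fun a => a 0 l), true, 1%N; split=> //; first exact: form_pos.
    by move=> t a; rewrite !row_tits_refl eqxx li cil /=; ring.
  have li : (l == i) = false.
    by apply: contraTF cjl => /eqP ->; rewrite c_sym.
  have ji : (j == i) = false by apply: contraTF jD => /eqP ->.
  exists (fun a => a 0 l + a 0 j), (c i l), 0%N; split=> //; first exact: form_pair.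
  by move=> t a; rewrite !row_tits_refl li ji (negPf cij) /=; ring.
Qed.

Lemma chamber_form_ge0 t w D a q : 1 <= t -> reduced w D -> (forall i, 0 <= a 0 i) ->
  chamber_form D q -> 0 <= q (a *m word_mx t w).
Proof.
move=> t1 wD a0; elim: wD q => [|{}w {}D i wD IH iD] q.
  rewrite mulmx1; case=> [i _|i|i j]; rewrite ?inE//; exact: a0.
move=> /(chamber_form_fire iD)[q0 [b [d [q0D d2 qE]]]].
rewrite word_mx_rcons mulmxA qE addr_ge0 ?IH// mulr_ge0//.
  have : d%:R <= 2 :> R by rewrite (ler_nat R d 2).
  by case: b {qE} => /=; lra.
by apply: (IH (fun a => a 0 i)); exact: form_pos.
Qed.

Definition ones : 'rV[R]_k := const_mx 1.

Definition height_row t w : 'rV[R]_k := ones *m word_mx t w.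

Lemma height_row_nil t : height_row t [::] = ones.
Proof. exact: mulmx1. Qed.

Lemma height_row_rcons t w i :
  height_row t (rcons w i) = height_row t w *m tits_refl t i.
Proof. by rewrite /height_row word_mx_rcons mulmxA. Qed.

Lemma height_form_ge0 t w D q : 1 <= t -> reduced w D -> chamber_form D q ->
  0 <= q (height_row t w).
Proof.
by move=> t1 wD; apply: chamber_form_ge0 => // i; rewrite mxE.
Qed.

Lemma normr_height t w D i : 1 <= t -> reduced w D ->
  exists2 q, chamber_form D q & forall s, 1 <= s ->
    `|height_row s w 0 i| = q (height_row s w).
Proof.
move=> t1 wD; have [iD|iD] := boolP (i \in D).
  have f := form_neg iD; exists (fun a => - a 0 i) => // s s1.
  by rewrite -normrN ger0_norm// (height_form_ge0 s1 wD f).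
have f := form_pos iD; exists (fun a => a 0 i) => // s s1.
by rewrite ger0_norm// (height_form_ge0 s1 wD f).
Qed.

(** Since [norm1 u * (1, ..., 1) + u] and [norm1 u * (1, ..., 1) - u] are both
    nonnegative rows, positivity of the chamber forms on them bounds each entry of
    [u *m word_mx t w]. *)
Lemma row_word_le t w D (u : 'rV[R]_k) : 1 <= t -> reduced w D ->
  norm1 (u *m word_mx t w) <= norm1 u * norm1 (height_row t w).
Proof.
move=> t1 wD; rewrite [in leLHS]norm1_row [norm1 (height_row _ _)]norm1_row mulr_sumr.
apply: ler_sum => i _.
have dom q : chamber_form D q ->
    (forall x y a b, q (x *: a + y *: b) = x * q a + y * q b) ->
    `|q (u *m word_mx t w)| <= norm1 u * q (height_row t w).
  move=> qD q_lin.
  have ge0 (e : R) : `|e| <= 1 -> 0 <= norm1 u * q (height_row t w)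
                                    + e * q (u *m word_mx t w).
    move=> e1.
    have := @chamber_form_ge0 t w D (norm1 u *: ones + e *: u) q t1 wD _ qD.
    rewrite mulmxDl -!scalemxAl q_lin.
    apply=> j; rewrite !mxE mulr1 -lerBlDl sub0r lerNl.
    apply: le_trans _ (ler_norm1 u 0 j); apply: le_trans (ler_norm _) _.
    by rewrite normrN normrM ler_piMl.
  rewrite ler_norml; apply/andP; split.
    by have := ge0 1; rewrite normr1 mul1r => /(_ (lexx _)); lra.
  by have := ge0 (-1); rewrite normrN1 mulN1r => /(_ (lexx _)); lra.
have [iD|iD] := boolP (i \in D).
  have := dom _ (form_neg iD); rewrite normrN => dom_i.
  apply: le_trans (dom_i _) _.
    by move=> x y a b; rewrite !mxE; ring.
  by rewrite ler_wpM2l ?norm1_ge0// -normrN ler_norm.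
apply: le_trans (dom _ (form_pos iD) _) _.
  by move=> x y a b; rewrite !mxE.
by rewrite ler_wpM2l ?norm1_ge0// ler_norm.
Qed.

Opaque height_row.

(** Each time the letter [i] turns from descent to non-descent its entry at least
    doubles in absolute value: the entry [a_l] of a neighbour that fires satisfies
    [|a_i| <= a_l], and [a_i] becomes [2 t a_l - |a_i|].  The factor 2 at
    descents accounts for the occurrence of [i] that has just been read. *)
Lemma height_growth t w D i : 3 / 2 <= t -> reduced w D ->
  2 ^+ count_mem i w <=
    (if i \in D then - (2 * height_row t w 0 i) else height_row t w 0 i).
Proof.
move=> t32 wD; elim: wD i => [|{}w {}D i wD IH iD] l.
  by rewrite inE height_row_nil mxE expr0.
have t1 : 1 <= t by lra.
have wi0 : 0 <= height_row t w 0 i := height_form_ge0 t1 wD (form_pos iD).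
have := IH l; rewrite height_row_rcons row_tits_refl -cats1 count_cat.
rewrite /= addn0 /fire_descents !inE [i == l]eq_sym.
case: eqP => [->|/eqP li] /=.
  by rewrite (negPf iD) addn1 exprS; lra.
rewrite addn0; case: (boolP (c i l)) => cil /=; last by rewrite mulr0 mul0r addr0.
case: (boolP (l \in D)) => lD IHl.
  have : 0 <= height_row t w 0 i + height_row t w 0 l.
    by apply: (height_form_ge0 t1 wD (form_pair lD _)); rewrite c_sym.
  by nra.
by nra.
Qed.

(** One firing step of [height_ratio]: [x] and [y] are the fired entries for the
    parameters [t] and [s], [x0] and [y0] the values of the old form, [mt] and [ms]
    the multipliers.  The bound with exponent [n + 1] uses the bound with exponent
    [n] on the fired entry, the missing factor [th] being supplied by
    [th * mt <= ms]; the errors add up by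
    [e^(n+1) + mx e^n <= (e + mx)^(n+1)]. *)
Lemma ratio_step (th mt ms mx x y x0 y0 e : R) :
  0 <= th -> 0 <= mt -> mt <= ms -> th * mt <= ms -> th * mt <= mx ->
  0 <= x -> 0 <= y -> 0 <= e ->
  x0 <= y0 /\ (forall n, th ^+ n * x0 <= y0 + e ^+ n) ->
  x <= y /\ (forall n, th ^+ n * x <= y + e ^+ n) ->
  x0 + mt * x <= y0 + ms * y /\
  forall n, th ^+ n * (x0 + mt * x) <= y0 + ms * y + (e + mx) ^+ n.
Proof.
move=> th0 mt0 mts h1 h2 x_ge0 y_ge0 e_ge0 [xy0 hx0] [xy hx].
have le1 : x0 + mt * x <= y0 + ms * y by apply: lerD => //; exact: ler_pM.
have mx0 : 0 <= mx by apply: le_trans h2; exact: mulr_ge0.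
split=> // -[|n]; first by rewrite !expr0 mul1r ler_wpDr.
apply: (@le_trans _ _ (y0 + ms * y + (e ^+ n.+1 + mx * e ^+ n))).
  have -> : th ^+ n.+1 * (x0 + mt * x) =
    th ^+ n.+1 * x0 + th * mt * (th ^+ n * x) by rewrite exprS; ring.
  rewrite addrACA; apply: lerD (hx0 _) _.
  apply: (@le_trans _ _ (th * mt * (y + e ^+ n))).
    by rewrite ler_wpM2l// mulr_ge0.
  by rewrite mulrDr lerD// ler_wpM2r// exprn_ge0.
rewrite lerD2l [e ^+ _]exprS -mulrDl exprS ler_wpM2l ?addr_ge0//.
by rewrite lerXn2r ?nnegrE ?addr_ge0// lerDl.
Qed.

(** The inequalities hold for all exponents [n] simultaneously, whence the
    induction on words rather than on [n]; it also needs the error-free comparison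
    for [n = 0]. *)
Lemma height_ratio t s w D q : 1 <= t -> t < s -> reduced w D ->
  chamber_form D q -> q (height_row t w) <= q (height_row s w) /\
  forall n, (s / t) ^+ n * q (height_row t w) <=
    q (height_row s w) + (s / t + 2 * s * (size w)%:R) ^+ n.
Proof.
move=> t1 ts wD; have t0 : 0 < t by lra.
have st1 : 1 < s / t by rewrite ltr_pdivlMr// mul1r.
have st0 : 0 <= s / t by lra.
have s1 : 1 <= s by lra.
have s0 : 0 <= 2 * s by lra.
have stt : s / t * t = s by rewrite divfK ?gt_eqF.
have mult (b : bool) (d : nat) : (d <= 2)%N ->
    [/\ 0 <= b%:R * (2 * t - d%:R), b%:R * (2 * t - d%:R) <= b%:R * (2 * s - d%:R),
     s / t * (b%:R * (2 * t - d%:R)) <= b%:R * (2 * s - d%:R) &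
     s / t * (b%:R * (2 * t - d%:R)) <= 2 * s].
  move=> d2; have d_ge0 : 0 <= d%:R :> R by [].
  have d_le2 : d%:R <= 2 :> R by rewrite (ler_nat R d 2).
  have d_st : d%:R <= s / t * d%:R by rewrite ler_peMl// ltW.
  case: b; rewrite ?mul1r ?mul0r ?mulr0//.
  by rewrite mulrBr mulrCA stt; split; lra.
elim: wD q => [|{}w {}D i wD IH iD] q.
  rewrite !height_row_nil mulr0 addr0.
  have E n : (0 : R) <= (s / t) ^+ n by rewrite exprn_ge0.
  case=> [l _|l|l j]; rewrite ?inE// !mxE; split=> // n.
  by rewrite mulr1 lerDr.
move=> /(chamber_form_fire iD)[q0 [b [d [q0D /(mult b d)[mt0 mts mst mle] qE]]]].
rewrite !height_row_rcons !qE size_rcons -(natr1 (size w)) (mulrDr (2 * s)).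
rewrite mulr1 (addrA (s / t)).
apply: ratio_step mt0 mts mst mle _ _ _ (IH _ q0D) (IH _ (form_pos iD)) => //.
- exact: height_form_ge0 t1 wD (form_pos iD).
- exact: height_form_ge0 s1 wD (form_pos iD).
- by rewrite addr_ge0// mulr_ge0.
Qed.

Lemma norm_height_ratio t s w D n : 1 <= t -> t < s -> reduced w D ->
  (s / t) ^+ n * norm1 (height_row t w) <=
    norm1 (height_row s w) + k%:R * (s / t + 2 * s * (size w)%:R) ^+ n.
Proof.
move=> t1 ts wD; rewrite !norm1_row mulr_sumr.
have -> : k%:R * (s / t + 2 * s * (size w)%:R) ^+ n =
    \sum_(i < k) (s / t + 2 * s * (size w)%:R) ^+ n :> R.
  by rewrite sumr_const card_ord mulr_natl.
rewrite -big_split; apply: ler_sum => i _ /=.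
have [q qD qE] := normr_height i t1 wD.
have [_ /(_ n)] := height_ratio t1 ts wD qD.
by rewrite (qE t t1) (qE s (le_trans t1 (ltW ts))).
Qed.


(** Choose [n] with [K + 1 <= (s / t)^n]: then [norm1 (height_row t w)] is at most
    the error term of [norm_height_ratio], a polynomial of degree [n] in the length
    of [w], whereas it is at least exponential in the number of occurrences of the
    most frequent letter. *)
Lemma finite_ratio_le t s (K : R) : 3 / 2 <= t -> t < s ->
  exists N0, forall w D, reduced w D ->
    norm1 (height_row s w) <= K * norm1 (height_row t w) -> (size w <= N0)%N.
Proof.
move=> t32 ts; have t1 : 1 <= t by lra.
have t0 : 0 < t by lra.
have st1 : 1 < s / t by rewrite ltr_pdivlMr// mul1r.
have s0 : 0 <= 2 * s by lra.
have [n Kn] := exists_expr_ge (K + 1) st1.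
pose beta := s / t + 2 * s * k%:R.
pose C := (n.+1 ^ n.+1)%:R * (2 * (k%:R * beta ^+ n)).
exists (k * Num.truncn C)%N => w D wD w_le.
have [->//|w_gt0] := posnP (size w).
have [i] := size_le_count w_gt0; rewrite card_ord; set M := count_mem i w => wM.
apply: leq_trans (wM) _; rewrite leq_mul2l; apply/orP; right.
have M_gt0 : (0 < M)%N.
  by move: wM w_gt0; case: (M) => [|//]; rewrite muln0 leqn0 => /eqP ->.
rewrite -ltnS -(ltr_nat R); apply: le_lt_trans (truncnS_gt C).
have Mn0 : 0 < M%:R ^+ n :> R by rewrite exprn_gt0// ltr0n.
rewrite -(ler_pM2r Mn0) -exprS -natrX.
have := expn_le_pow2 M n; rewrite -(ler_nat R) => /le_trans; apply.
rewrite natrM /C -!mulrA ler_wpM2l// natrX.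
have pow_le : 2 ^+ M <= 2 * norm1 (height_row t w).
  apply: le_trans (height_growth i t32 wD) _.
  have entry_le := ler_norm1 (height_row t w) 0 i.
  case: ifP => _; first rewrite -mulrN ler_wpM2l//; apply: le_trans (ler_norm _) _.
    by rewrite normrN.
  by apply: le_trans entry_le _; rewrite ler_peMl ?norm1_ge0// ler1n.
apply: le_trans pow_le _; rewrite ler_wpM2l//.
have norm_le : norm1 (height_row t w) <= k%:R * (s / t + 2 * s * (size w)%:R) ^+ n.
  rewrite -(lerD2l (K * norm1 (height_row t w))) -[X in _ + X <= _]mul1r -mulrDl.
  apply: le_trans (ler_wpM2r (norm1_ge0 _) Kn) _.
  by apply: le_trans (norm_height_ratio n t1 ts wD) _; rewrite lerD2r.
apply: le_trans norm_le _; rewrite ler_wpM2l// -exprMn.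
have M1 : 1 <= M%:R :> R by rewrite ler1n.
have wMR : (size w)%:R <= k%:R * M%:R :> R by rewrite -natrM ler_nat.
have base_ge0 : 0 <= s / t + 2 * s * (size w)%:R.
  by apply: addr_ge0; [rewrite ltW// (lt_trans ltr01)|exact: mulr_ge0].
have base_le : s / t + 2 * s * (size w)%:R <= beta * M%:R.
  rewrite /beta [(_ + _) * M%:R]mulrDl lerD//; last by rewrite -(mulrA (2 * s)) ler_wpM2l.
  by rewrite ler_peMr// ltW// (lt_trans ltr01).
by rewrite lerXn2r ?nnegrE// (le_trans base_ge0).
Qed.

(** The last letter of a nonempty reduced word is a descent, where the entry is
    nonpositive. *)
Lemma reduced_height_gt0 t w D : 1 <= t -> reduced w D ->
  (forall i, 0 < height_row t w 0 i) -> w = [::].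
Proof.
move=> t1; case=> [//|{}w {}D i wD iD] h0.
have iD' : i \in fire_descents i D by rewrite !inE eqxx.
have := height_form_ge0 t1 (reduced_rcons wD iD) (form_neg iD').
by rewrite leNgt oppr_lt0 h0.
Qed.

Lemma norm_height_conj t s w D (X Y : 'M[R]_k) : 1 <= t -> reduced w D ->
  word_mx s w = X *m word_mx t w *m Y ->
  norm1 (height_row s w) <= norm1 ones * norm1 X * norm1 Y * norm1 (height_row t w).
Proof.
move=> t1 wD wE; have -> : height_row s w = ones *m X *m word_mx t w *m Y.
  by rewrite -[LHS]/(ones *m word_mx s w) wE !mulmxA.
apply: le_trans (norm1M _ _) _; rewrite [in leRHS]mulrAC ler_wpM2r ?norm1_ge0//.
apply: le_trans (row_word_le _ t1 wD) _; rewrite ler_wpM2r ?norm1_ge0//.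
exact: norm1M.
Qed.

Lemma word_mx_form t w :
  (word_mx t w)^T *m tits_form t *m word_mx t w = tits_form t.
Proof.
elim: w => [|i w IHw] /=; first by rewrite trmx1 mul1mx mulmx1.
rewrite trmx_mul -!mulmxA [_^T *m (tits_form t *m _)]mulmxA.
by rewrite [_^T *m tits_form t *m _]mulmxA tits_refl_form mulmxA.
Qed.

End Game.

(** * Reduced words in a right-angled Coxeter group *)

Section CoxeterWords.
Context {R : realType} (k : nat) (Gamma : groupType) (gen : 'I_k -> Gamma).
Variable m : 'I_k -> 'I_k -> option nat.
Hypotheses (m_ra : right_angled_matrix m)
  (presented : presented_by gen (coxeter_relators m)).

Definition noncommuting : rel 'I_k := fun i j => m i j == None.

Lemma noncommuting_sym : symmetric noncommuting.
Proof. by move=> i j; rewrite /noncommuting; case: m_ra => _ -> _. Qed.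

Lemma noncommuting_irr : irreflexive noncommuting.
Proof. by move=> i; rewrite /noncommuting; case: m_ra => -> _ _. Qed.

Definition pos_word (w : seq 'I_k) : word 'I_k := [seq (i, false) | i <- w].

Definition gval (w : seq 'I_k) : Gamma := word_val gen (pos_word w).

Lemma word_val_cat (v w : word 'I_k) :
  word_val gen (v ++ w) = (word_val gen v * word_val gen w)%g.
Proof. by elim: v => [|x v IHv] /=; rewrite ?mul1g// IHv mulgA. Qed.

Lemma gval_cat v w : gval (v ++ w) = (gval v * gval w)%g.
Proof. by rewrite /gval /pos_word map_cat word_val_cat. Qed.

Lemma gval_rcons w i : gval (rcons w i) = (gval w * gen i)%g.
Proof. by rewrite -cats1 gval_cat /gval /= mulg1. Qed.

Lemma relator_val i j n : m i j = Some n ->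
  word_val gen (flatten (nseq n [:: (i, false); (j, false)])) = 1%g.
Proof.
by move=> mij; case: presented => _ ->; apply: WCrel; exists i, j, n.
Qed.

Lemma gen_invol i : (gen i * gen i = 1)%g.
Proof.
have := @relator_val i i 1; case: m_ra => -> _ _ /(_ erefl) /=.
by rewrite mulg1.
Qed.

Lemma gen_inv i : (gen i)^-1%g = gen i.
Proof. by rewrite -[RHS]mul1g -(mulVg (gen i)) -mulgA gen_invol mulg1. Qed.

Lemma gen_comm i j : i != j -> ~~ noncommuting i j ->
  (gen i * gen j = gen j * gen i)%g.
Proof.
move=> ij; rewrite /noncommuting; case: m_ra => _ _ /(_ i j ij)[mij|->//] _.
have /= := relator_val mij; rewrite mulg1 => ijij.
rewrite -[LHS]mulg1 -(gen_invol i) -[X in (_ * (X * _))%g]mulg1 -(gen_invol j).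
rewrite -[RHS]mul1g -ijij !mulgA.
by rewrite -[(gen i * gen j * gen i * gen j * gen j)%g]mulgA gen_invol mulg1
  -[(gen i * gen j * gen i * gen i)%g]mulgA gen_invol mulg1.
Qed.

Lemma word_val_pos (v : word 'I_k) : word_val gen v = gval (map fst v).
Proof.
elim: v => [//|[i b] v IHv]; rewrite /= IHv /gval /=.
by case: b => //=; rewrite gen_inv.
Qed.

Local Notation S t i := (tits_refl (R := R) noncommuting t i).
Local Notation M t w := (word_mx (R := R) noncommuting t w).

Lemma word_mx_congr t (v w : word 'I_k) :
  word_congr (coxeter_relators m) v w -> M t (map fst v) = M t (map fst w).
Proof.
elim=> {v w} [//|//|u v w _ -> _ ->//|v v' w w' _ vE _ wE|i b|].
- by rewrite !map_cat !word_mx_cat vE wE.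
- by rewrite /= mulmx1 tits_refl_invol//; exact: noncommuting_irr.
- move=> _ [i [j [n [mij ->]]]]; have [ij|ij] := eqVneq i j.
    move: mij; rewrite ij; case: m_ra => -> _ _ [<-] /=.
    by rewrite mulmx1 tits_refl_invol//; exact: noncommuting_irr.
  case: (m_ra) => _ _ /(_ i j ij)[|]; rewrite mij// => -[->] /=.
  have comm : S t i *m S t j = S t j *m S t i.
    apply: tits_refl_comm => //; first exact: noncommuting_sym.
    by rewrite /noncommuting mij.
  rewrite mulmx1 mulmxA {1}comm.
  rewrite -mulmxA [S t i *m _]mulmxA tits_refl_invol ?mul1mx; last exact: noncommuting_irr.
  by rewrite tits_refl_invol//; exact: noncommuting_irr.
Qed.

Lemma word_mx_rev t w : M t (rev w) *m M t w = 1%:M.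
Proof.
elim: w => [|i w IHw]; first by rewrite mulmx1.
rewrite rev_cons word_mx_rcons /= -mulmxA [S t i *m _]mulmxA.
by rewrite tits_refl_invol ?mul1mx//; exact: noncommuting_irr.
Qed.

Lemma gval_rev w : (gval w * gval (rev w) = 1)%g.
Proof.
elim: w => [|i w IHw]; first by rewrite mulg1.
rewrite rev_cons gval_rcons -cat1s gval_cat /= -mulgA [(gval w * _)%g]mulgA IHw.
by rewrite mul1g /gval /= mulg1 gen_invol.
Qed.

Lemma word_mx_gval t v w : gval v = gval w -> M t v = M t w.
Proof.
move=> vw; have : gval (v ++ rev w) = 1%g by rewrite gval_cat vw gval_rev.
case: presented => _ pres /pres /(word_mx_congr t).
rewrite -map_comp map_id word_mx_cat => vw1.
by rewrite -[LHS]mulmx1 -(word_mx_rev t w) mulmxA vw1 mul1mx.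
Qed.

Local Notation reduced := (reduced noncommuting).

(** Deletion: after the last occurrence of a descent [i], only letters commuting
    with [i] have been read, so this occurrence can be moved to the end. *)
Lemma gval_cancel w D i : reduced w D -> i \in D ->
  exists2 v, (size v < size w)%N & gval w = (gval v * gen i)%g.
Proof.
elim=> {w D} [|w D j wD IHw jD]; rewrite !inE// size_rcons.
move=> /predU1P[->|/andP[cji iD]]; first by exists w => //; rewrite gval_rcons.
have [v vw wE] := IHw iD; exists (rcons v j); first by rewrite size_rcons.
have ij : i != j by apply: contraTN iD => /eqP ->.
rewrite !gval_rcons wE -!mulgA gen_comm//.
by rewrite noncommuting_sym.
Qed.

Lemma exists_reduced w :
  exists v D, [/\ reduced v D, gval v = gval w & (size v <= size w)%N].
Proof.
have [n] := ubnP (size w); elim: n w => [//|n IHn] w.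
case/lastP: w => [_|w i]; first by exists [::], finset.set0; split=> //; exact: reduced_nil.
rewrite size_rcons ltnS => wn; have [v [D [vD vE vw]]] := IHn w wn.
have [iD|iD] := boolP (i \in D).
  have [u uv uE] := gval_cancel vD iD.
  have [|u' [D' [uD' u'E u'u]]] := IHn u.
    exact: leq_trans uv (leq_trans vw (ltnW wn)).
  exists u', D'; split=> //.
    by rewrite u'E gval_rcons -vE uE -mulgA gen_invol mulg1.
  by apply: leq_trans u'u _; rewrite ltnW// ltnS (leq_trans (ltnW uv)).
exists (rcons v i), (fire_descents noncommuting i D).
by split; [exact: reduced_rcons|rewrite !gval_rcons vE|rewrite size_rcons].
Qed.

Lemma exists_reduced_word (x : Gamma) : exists wD, reduced wD.1 wD.2 /\ gval wD.1 = x.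
Proof.
case: presented => /(_ x)[v ->] _; rewrite word_val_pos.
have [w [D [wD wE _]]] := exists_reduced (map fst v).
by exists (w, D).
Qed.

End CoxeterWords.

(** * Orthogonal groups and isometries with the Tits form *)

Section Orthogonal.
Context {R : realType}.

Definition signature_mx p r : 'M[R]_(p + r) := block_mx 1%:M 0 0 (- 1%:M).

Lemma signature_mxK p r : signature_mx p r *m signature_mx p r = 1%:M.
Proof.
rewrite mulmx_block !mulmx0 !mul0mx !addr0 add0r mulmx1 mulNmx mulmxN opprK mulmx1.
by rewrite -scalar_mx_block.
Qed.

Lemma mx_entry_form n (A : 'M[R]_n) i j :
  ((delta_mx i 0 : 'cV_n)^T *m A *m (delta_mx j 0 : 'cV_n)) 0 0 = A i j.
Proof. by rewrite trmx_delta -rowE -colE !mxE. Qed.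

Lemma orthogonal_groupP p r (g : 'M[R]_(p + r)) :
  orthogonal_group g <-> g^T *m signature_mx p r *m g = signature_mx p r.
Proof.
have formE u v : signature_form (g *m u) (g *m v) =
    (u^T *m (g^T *m signature_mx p r *m g) *m v) 0 0.
  by rewrite /signature_form trmx_mul !mulmxA.
split=> [[_ gJ]|gJ].
  by apply/matrixP => i j; rewrite -[LHS]mx_entry_form -formE gJ;
    exact: mx_entry_form.
split=> [|u v]; last by rewrite formE gJ.
have [] := @mulmx1_unit _ _ (signature_mx p r *m g^T *m signature_mx p r) g _ => //.
by rewrite -!mulmxA [g^T *m _]mulmxA gJ signature_mxK.
Qed.

(** The entries of [g^-1] are those of [g] up to position and sign; compact sets of
    orthogonal matrices therefore have bounded inverses. *)
Lemma orthogonal_inv p r (g : 'M[R]_(p + r)) : orthogonal_group g ->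
  invmx g = signature_mx p r *m g^T *m signature_mx p r.
Proof.
move=> Og; have [gu _] := Og; move/orthogonal_groupP: Og => gJ.
rewrite -[RHS]mulmx1 -(mulmxV gu) mulmxA -[X in _ = X *m _]mulmxA.
by rewrite -mulmxA [g^T *m _]mulmxA gJ signature_mxK mul1mx.
Qed.

Lemma norm1_tr m n (A : 'M[R]_(m, n)) : norm1 A^T = norm1 A.
Proof.
rewrite /norm1 exchange_big; apply: eq_bigr => i _; apply: eq_bigr => j _.
by rewrite mxE.
Qed.

Lemma norm1_le_norm m n (A : 'M[R]_(m, n)) : norm1 A <= (m * n)%:R * `|A|.
Proof.
have entry i j : `|A i j| <= `|A|.
  rewrite [leRHS]/Num.norm/= mx_normrE.
  exact: (le_bigmax _ (fun ij => `|A ij.1 ij.2|) (i, j)).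
apply: (@le_trans _ _ (\sum_(i < m) \sum_(j < n) `|A|)).
  by apply: ler_sum => i _; apply: ler_sum => j _.
by rewrite !sumr_const !card_ord -mulrnA mulr_natl mulnC.
Qed.

Lemma compact_norm1 m n (C : set 'M[R]_(m, n)) : compact C ->
  exists2 K, 0 <= K & forall g, C g -> norm1 g <= K.
Proof.
move=> /compact_bounded[N [_ NC]]; exists ((m * n)%:R * `|N + 1|) => [|g Cg].
  by rewrite mulr_ge0.
apply: le_trans (norm1_le_norm g) _; rewrite ler_wpM2l//.
apply: le_trans (ler_norm _); apply: NC => //.
by rewrite ltrDl.
Qed.

Lemma near_norm1 m n (x : 'M[R]_(m, n)) (e : R) : 0 < e ->
  \forall g \near x, norm1 (g - x) < e.
Proof.
move=> e0; have d0 : 0 < e / (m * n).+1%:R by rewrite divr_gt0.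
near=> g; apply: le_lt_trans (norm1_le_norm _) _.
have : `|x - g| < e / (m * n).+1%:R by near: g; exact: cvgr_dist_lt.
rewrite distrC ltr_pdivlMr// mulrC; apply: le_lt_trans.
by rewrite ler_wpM2r// ler_nat.
Unshelve. all: by end_near. Qed.

Lemma mulmx1C_eq m n (A : 'M[R]_(m, n)) (B : 'M[R]_(n, m)) :
  m = n -> B *m A = 1%:M -> A *m B = 1%:M.
Proof. by move=> mn; case: n / mn A B => A B; exact: mulmx1C. Qed.

End Orthogonal.

Section Isometry.
Context {R : realType} (k : nat) (c : rel 'I_k).
Hypotheses (c_sym : symmetric c) (c_irr : irreflexive c) (k_gt0 : (0 < k)%N).

(** [P t] is an isometry from [- B_t] to the standard form, and
    [Q t = - B_t^-1 P_t^T J] its inverse, which is smooth because [B_t] is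
    invertible on the interval. *)
Lemma tits_form_isometry (a b : R) : a < b -> exists p q x y,
  [/\ (p + q + 1 = k)%N, x < y, {subset `]x, y[ <= `]a, b[} &
  exists (P : R -> 'M[R]_(p + (q + 1), k)) (Q : R -> 'M[R]_(k, p + (q + 1))),
  [/\ smooth_mx [set` `]x, y[] P, smooth_mx [set` `]x, y[] Q &
  forall t, t \in `]x, y[ -> [/\ P t *m Q t = 1%:M, Q t *m P t = 1%:M &
    (P t)^T *m signature_mx p (q + 1) *m P t = - tits_form c t]]].
Proof.
move=> ab; have [x [y [xy xyab [r [p [N [P [rp Ns Ps NP]]]]]]]] :=
  smooth_splitting (adjacencyT (R := R) c_sym) ab.
(* A form of negative index 0 cannot take the value -1 at a basis vector. *)
have [q qE] : exists q, r = (q + 1)%N.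
  exists r.-1; rewrite addn1 prednK// lt0n; apply/eqP => r0.
  have /NP[_ NPt] : (x + y) / 2 \in `]x, y[ by rewrite mid_in_itv.
  pose o := Ordinal k_gt0; have := tits_form_diag (R := R) c_irr ((x + y) / 2) o.
  rewrite /tits_form NPt mxE [X in X + _]mxE big1 ?add0r; last first.
    by move=> i; have := ltn_ord i; rewrite {2}r0.
  rewrite mxE => /eqP; rewrite eqr_oppLR => /eqP PPE.
  have : 0 <= ((P ((x + y) / 2))^T *m P ((x + y) / 2)) o o.
    by rewrite mxE sumr_ge0// => i _; rewrite mxE -expr2 sqr_ge0.
  by rewrite PPE oppr_ge0 ler10.
subst r; exists p, q, x, y; split=> //; first by rewrite -addnA addnC.
pose T t := col_mx (P t) (N t).
pose J := signature_mx (R := R) p (q + 1).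
have TJ t : t \in `]x, y[ -> (T t)^T *m J *m T t = - tits_form c t.
  move=> /NP[_ NPt]; rewrite /T /J tr_col_mx mul_row_block !mulmx0 mulmx1 addr0 add0r.
  by rewrite mulmxN mulmx1 mul_row_col mulNmx /tits_form NPt opprB.
have T_s : smooth_mx [set` `]x, y[] T by exact: smooth_col_mx.
exists T, (fun t => - invmx (tits_form c t) *m (T t)^T *m J); split=> //.
  apply: smooth_mxM; last exact: smooth_mx_cst.
  apply: smooth_mxM; last exact: smooth_mxT.
  apply: smooth_mxN; apply: smooth_mx_inv => //.
    by move=> t /NP[].
  apply: smooth_mxD; first exact: smooth_mx_cst.
  by apply: smooth_mxN; apply: smooth_mxZ; [exact: smooth_id|exact: smooth_mx_cst].
move=> t txy; have [Bu _] := NP t txy.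
have QT : - invmx (tits_form c t) *m (T t)^T *m J *m T t = 1%:M.
  by rewrite -!mulmxA [_^T *m _]mulmxA TJ// mulmxN mulNmx opprK mulVmx.
split; [|exact: QT|exact: TJ].
by apply: mulmx1C_eq => //; rewrite addnC.
Qed.

End Isometry.

Section Transport.
Context {R : realType} (k : nat).

Lemma transport_orthogonal p r (P : 'M[R]_(p + r, k)) (Q : 'M[R]_(k, p + r))
    (B M : 'M[R]_k) :
  P *m Q = 1%:M -> P^T *m signature_mx p r *m P = - B -> M^T *m B *m M = B ->
  orthogonal_group (P *m M *m Q).
Proof.
move=> PQ PB MB; apply/orthogonal_groupP.
have -> : (P *m M *m Q)^T *m signature_mx p r *m (P *m M *m Q) =
    Q^T *m (M^T *m (P^T *m signature_mx p r *m P) *m M) *m Q.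
  by rewrite !trmx_mul !mulmxA.
rewrite PB mulmxN mulNmx MB -PB !mulmxA -mulmxA PQ mulmx1 -trmx_mul PQ.
by rewrite trmx1 mul1mx.
Qed.

Lemma transportK n (P : 'M[R]_(n, k)) (Q : 'M[R]_(k, n)) (QP : Q *m P = 1%:M)
    (M : 'M[R]_k) : Q *m (P *m M *m Q) *m P = M.
Proof. by rewrite !mulmxA QP mul1mx -mulmxA QP mulmx1. Qed.

End Transport.

(** * The deformation of the Tits representation *)

Section TitsRepresentation.
Context {R : realType} (k : nat) (Gamma : groupType) (gen : 'I_k -> Gamma).
Variable m : 'I_k -> 'I_k -> option nat.
Hypotheses (m_ra : right_angled_matrix m)
  (presented : presented_by gen (coxeter_relators m)).
Local Notation c := (noncommuting m).
Variable wd : Gamma -> seq 'I_k * {set 'I_k}.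
Hypothesis wdP : forall x, reduced c (wd x).1 (wd x).2 /\ gval gen (wd x).1 = x.

Definition tits_rep (t : R) (x : Gamma) : 'M[R]_k := word_mx c t (wd x).1.

Let c_sym := noncommuting_sym m_ra.
Let c_irr := noncommuting_irr m_ra.

Lemma tits_repM t x y : tits_rep t (x * y)%g = tits_rep t x *m tits_rep t y.
Proof.
rewrite -word_mx_cat; apply: (word_mx_gval m_ra presented).
by rewrite gval_cat !(wdP _).2.
Qed.

Lemma tits_rep1 t : tits_rep t 1%g = 1%:M.
Proof.
rewrite -[RHS]/(word_mx c t [::]); apply: (word_mx_gval m_ra presented).
by rewrite (wdP _).2.
Qed.

Lemma tits_rep_form t x :
  (tits_rep t x)^T *m tits_form c t *m tits_rep t x = tits_form c t.
Proof. exact: word_mx_form. Qed.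

Lemma smooth_tits_rep U x : smooth_mx U (fun t => tits_rep t x).
Proof.
rewrite /tits_rep; elim: (wd x).1 => [|i w IHw] /=; first exact: smooth_mx_cst.
apply: smooth_mxM => //; apply: smooth_mxD; first exact: smooth_mx_cst.
apply: smooth_mxN; apply: smooth_mxZ; first exact: smooth_cst.
apply: smooth_mxM; first exact: smooth_mx_cst.
apply: smooth_mxD; first exact: smooth_mx_cst.
by apply: smooth_mxN; apply: smooth_mxZ; [exact: smooth_id|exact: smooth_mx_cst].
Qed.

Lemma tits_rep_pos t x : 1 <= t ->
  (forall i, 0 < (ones k *m tits_rep t x) 0 i) -> x = 1%g.
Proof.
move=> t1 x0; have [wD wx] := wdP x.
by rewrite -wx (reduced_height_gt0 c_sym c_irr t1 wD x0).
Qed.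

(** By symmetry [t < s] may be assumed, and then the first of the two
    factorisations bounds [norm1 (height_row s)] by a constant multiple of
    [norm1 (height_row t)]. *)
Lemma finite_tits_rep_conj (t s K : R) : 3 / 2 <= t -> 3 / 2 <= s -> t != s ->
  finite_set [set x : Gamma |
    (exists X Y : 'M[R]_k, [/\ norm1 X <= K, norm1 Y <= K &
       tits_rep s x = X *m tits_rep t x *m Y]) /\
    (exists X Y : 'M[R]_k, [/\ norm1 X <= K, norm1 Y <= K &
       tits_rep t x = X *m tits_rep s x *m Y])].
Proof.
wlog ts : t s / t < s => [hwlog t32 s32 ts|].
  have [lt_ts|lt_st|eq_ts] := ltgtP t s; first exact: hwlog.
    by apply: (sub_finite_set _ (hwlog s t lt_st s32 t32 _)) => [x []|]; rewrite 1?eq_sym.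
  by rewrite eq_ts eqxx in ts.
move=> t32 _ _.
have [N0 N0P] := finite_ratio_le c_sym c_irr (norm1 (ones (R := R) k) * K * K) t32 ts.
apply: sub_finite_set (finite_image (fun w => gval gen w) (@finite_words _ N0)).
move=> x [[X [Y [XK YK xE]]] _]; have [wD wx] := wdP x.
exists (wd x).1 => //=; apply: (N0P _ _ wD).
have t1 : 1 <= t by apply: le_trans t32; lra.
apply: le_trans (norm_height_conj c_sym c_irr t1 wD xE) _.
rewrite ler_wpM2r ?norm1_ge0// ler_pM ?mulr_ge0 ?norm1_ge0//.
by rewrite ler_wpM2l ?norm1_ge0.
Qed.

(** An element [h] with [rho h] close to [rho g] has [tits_rep t (g^-1 h)] close to
    the identity, hence a height row with positive entries only, and is [g]. *)
Lemma tits_rep_separated t n (P : 'M[R]_(n, k)) (Q : 'M[R]_(k, n)) g :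
  1 <= t -> Q *m P = 1%:M -> let rho x := P *m tits_rep t x *m Q in
  exists2 e, 0 < e & forall h, norm1 (rho h - rho g) < e -> h = g.
Proof.
move=> t1 QP rho; pose A := ones k *m tits_rep t g^-1%g *m Q.
have d0 : 0 < norm1 A * norm1 P + 1.
  by rewrite ltr_wpDl ?mulr_ge0 ?norm1_ge0.
exists (norm1 A * norm1 P + 1)^-1 => [|h hg]; first by rewrite invr_gt0.
suff: (g^-1 * h)%g = 1%g.
  by move=> /(congr1 (fun z => (g * z)%g)); rewrite mulgA mulgV mul1g mulg1.
apply: (tits_rep_pos t1) => i.
have AE h' : A *m rho h' *m P = ones k *m tits_rep t (g^-1 * h')%g.
  transitivity (ones k *m tits_rep t g^-1%g *m (Q *m rho h' *m P)).
    by rewrite /A !mulmxA.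
  by rewrite transportK// tits_repM mulmxA.
have -> : ones k *m tits_rep t (g^-1 * h)%g =
    ones k + A *m (rho h - rho g) *m P.
  by rewrite mulmxBr mulmxBl !AE mulVg tits_rep1 mulmx1 addrC subrK.
rewrite mxE [X in X + _]mxE; set z := (_ *m _ *m _) 0 i.
have : `|z| < 1.
  apply: le_lt_trans (ler_norm1 _ 0 i) _.
  apply: le_lt_trans (norm1M _ _) _.
  apply: le_lt_trans (ler_wpM2r (norm1_ge0 _) (norm1M _ _)) _.
  move: hg; rewrite -[X in _ < X]mul1r ltr_pdivlMr//.
  have := norm1_ge0 (rho h - rho g).
  by move: (norm1 _) (norm1 _) (norm1 _) => a b d; nra.
by rewrite ltr_norml => /andP[]; lra.
Qed.

Lemma tits_rep_faithful_discrete t n (P : 'M[R]_(n, k)) (Q : 'M[R]_(k, n)) :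
  1 <= t -> Q *m P = 1%:M ->
  faithful_discrete (fun x => P *m tits_rep t x *m Q).
Proof.
move=> t1 QP; have sep g := tits_rep_separated g t1 QP.
have norm1_subrr (x : 'M[R]_n) : norm1 (x - x) = 0.
  rewrite subrr /norm1 big1// => i _; rewrite big1// => j _.
  by rewrite mxE normr0.
split=> [g h gh|_ [g _ <-]].
  by have [e e0 esep] := sep h; apply: esep; rewrite gh norm1_subrr.
split; first by rewrite inE; exists g.
have [e e0 esep] := sep g.
exists [set z | norm1 (z - P *m tits_rep t g *m Q) < e]; first exact: near_norm1.
apply/seteqP; split=> [z [/= zg [h _ hE]]|_ ->].
  by move: zg; rewrite -hE => /esep ->.
by split; [rewrite /= norm1_subrr|exists g].
Qed.

(** If [g] and [g' = rho' x g (rho x)^-1] both lie in [C], then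
    [rho' x = g' (rho x) g^-1] and [rho x = g'^-1 (rho' x) g], where all four
    outer factors are bounded in terms of [C]. *)
Lemma tits_rep_proper t s p r (P P' : 'M[R]_(p + r, k)) (Q Q' : 'M[R]_(k, p + r)) :
  3 / 2 <= t -> 3 / 2 <= s -> t != s -> Q *m P = 1%:M -> Q' *m P' = 1%:M ->
  (forall x, P *m tits_rep t x *m Q \in unitmx) ->
  properly_discontinuous (@orthogonal_group R p r)
    (right_left_action (fun x => P *m tits_rep t x *m Q)
                       (fun x => P' *m tits_rep s x *m Q')).
Proof.
move=> t32 s32 ts QP QP' rho_unit C CO cC; have [K K0 CK] := compact_norm1 cC.
pose J := signature_mx (R := R) p r; pose K' := norm1 J * K * norm1 J.
have CKV g : C g -> norm1 (invmx g) <= K'.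
  move=> Cg; rewrite orthogonal_inv; last exact: CO.
  apply: le_trans (norm1M _ _) _; rewrite ler_wpM2r ?norm1_ge0//.
  apply: le_trans (norm1M _ _) _; rewrite ler_wpM2l ?norm1_ge0// norm1_tr.
  exact: CK.
have K'0 : 0 <= K' by rewrite !mulr_ge0 ?norm1_ge0.
pose d := norm1 P + norm1 Q + norm1 P' + norm1 Q'.
have [PD QD PD' QD'] :
    [/\ norm1 P <= d, norm1 Q <= d, norm1 P' <= d & norm1 Q' <= d].
  have := norm1_ge0 P; have := norm1_ge0 Q.
  have := norm1_ge0 P'; have := norm1_ge0 Q'; rewrite /d.
  by move: (norm1 _) (norm1 _) (norm1 _) (norm1 _) => a b c' e; split; lra.
have bound a b (X : 'M[R]_(k, a)) (g : 'M[R]_(a, b)) (Y : 'M[R]_(b, k)) :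
    norm1 X <= d -> norm1 g <= K + K' -> norm1 Y <= d ->
    norm1 (X *m g *m Y) <= d * (K + K') * d.
  move=> Xd gK Yd; apply: le_trans (norm1M _ _) _.
  rewrite ler_pM ?norm1_ge0//; apply: le_trans (norm1M _ _) _.
  by rewrite ler_pM ?norm1_ge0.
apply: sub_finite_set (finite_tits_rep_conj (d * (K + K') * d) t32 s32 ts).
move=> x [_ [[g Cg <-]]].
rewrite /right_left_action; set g' := (_ *m _ *m _) => Cg'.
have [gu _] := CO _ Cg; have [gu' _] := CO _ Cg'.
have g'r : g' *m (P *m tits_rep t x *m Q) = P' *m tits_rep s x *m Q' *m g.
  by rewrite mulmxKV.
have [gK g'K gVK gV'K] : [/\ norm1 g <= K + K', norm1 g' <= K + K',
    norm1 (invmx g) <= K + K' & norm1 (invmx g') <= K + K'].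
  split; first [by apply: ler_wpDr => //; exact: CK
               |by apply: ler_wpDl => //; exact: CKV].
split.
  exists (Q' *m g' *m P), (Q *m invmx g *m P'); split; [exact: bound..|].
  rewrite -[LHS](transportK QP').
  have -> : P' *m tits_rep s x *m Q' = g' *m (P *m tits_rep t x *m Q) *m invmx g.
    by rewrite g'r mulmxK.
  by rewrite !mulmxA.
exists (Q *m invmx g' *m P'), (Q' *m g *m P); split; [exact: bound..|].
rewrite -[LHS](transportK QP).
have -> : P *m tits_rep t x *m Q = invmx g' *m (P' *m tits_rep s x *m Q' *m g).
  by rewrite -g'r mulKmx.
by rewrite !mulmxA.
Qed.

End TitsRepresentation.

Unset Implicit Arguments.

Theorem theorem1p7 (R : realType) (k : nat) (k_gt0 : (0 < k)%N)
    (Gamma : groupType) (gen : 'I_k -> Gamma)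
    (Gamma_racg : right_angled_coxeter gen)
    (Gamma_irr : irreducible_generators (range gen)) :
  exists p q : nat, (p + q + 1 = k)%N /\
  exists (I : set R) (rho : R -> Gamma -> 'M[R]_(p + (q + 1))),
    [/\ open I, is_interval I & I !=set0] /\
    [/\ forall t, I t -> is_representation (@orthogonal_group R p (q + 1)) (rho t),
        forall t, I t -> faithful_discrete (rho t),
        smooth_path I rho &
        forall t s, I t -> I s -> t != s ->
          properly_discontinuous (@orthogonal_group R p (q + 1))
            (right_left_action (rho t) (rho s))].
Proof.
have [m [m_ra pres]] := Gamma_racg.
have [wd wdP] := choice (exists_reduced_word m_ra pres).
(* Any interval to the right of 3/2 would do: there the growth estimates hold. *)
have [p [q [x [y [pqk xy xy23 [P [Q [Ps Qs PQ]]]]]]]] :=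
  tits_form_isometry (noncommuting_sym m_ra) (noncommuting_irr m_ra) k_gt0
    (ltr_nat R 2 3 : (2 < 3 :> R) = true).
exists p, q; split=> //.
pose M := tits_rep (R := R) m wd; pose U := [set` `]x, y[].
exists U, (fun t g => P t *m M t g *m Q t); split.
  split; [exact: interval_open|exact: interval_is_interval|].
  by exists ((x + y) / 2); rewrite /U /= mid_in_itv.
have U32 t : U t -> 3 / 2 <= t.
  by move=> /xy23; rewrite in_itv/= => /andP[/ltW t2 _]; lra.
have rhoO t g : U t -> orthogonal_group (P t *m M t g *m Q t).
  move=> /PQ[PQ1 _ PB]; apply: (transport_orthogonal PQ1 PB).
  exact: tits_rep_form.
split.
- move=> t Ut; split=> [g|g h]; first exact: rhoO.
  have [_ QP _] := PQ t Ut; rewrite /M (tits_repM m_ra pres wdP).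
  by rewrite -!mulmxA [Q t *m (P t *m _)]mulmxA QP mul1mx.
- move=> t Ut; have [_ QP _] := PQ t Ut.
  apply: (tits_rep_faithful_discrete m_ra pres wdP _ QP).
  by apply: le_trans (U32 t Ut); lra.
- move=> g i j; apply: smooth_smooth_on; first exact: interval_open.
  apply: (smooth_mxM (F := fun t => P t *m M t g)) => //.
  by apply: smooth_mxM => //; exact: smooth_tits_rep.
- move=> t s Ut Us ts; have [[_ QPt _] [_ QPs _]] := (PQ t Ut, PQ s Us).
  apply: (tits_rep_proper m_ra wdP (U32 t Ut) (U32 s Us) ts QPt QPs) => g.
  by have [] := rhoO t g Ut.
Qed.
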